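(* There is a register machine (addition machine) with four integer registers which, on input of integers $y$ and $z$ with $z\neq 0$, outputs $\lfloor y/z\rfloor$ and executes $O(m)$ steps, where $m$ is the smallest natural number such that $2^m\cdot|z|\geq |y|$.
   Context: Model (addition machine): a program is a finite list of numbered lines; the machine has finitely many registers, each holding an arbitrary integer. Allowed commands, each counting as one step, are: $x=y+z$, $x=y+k$, $x=y-z$, $x=y-k$, $x=k-y$, $x=k$ (for registers $x,y,z$, not necessarily distinct, and integer constants $k$); ''read $x$'' (reads one whole integer input into a register) and ''write $x$'' (outputs the whole content of a register); ''if $x\,R\,y$ then ... else ...'' and ''if $x\,R\,k$ then ... else ...'' with $R\in\{<,=,>,\neq,\leq,\geq\}$; and ''goto $\ell$'' for a fixed line number $\ell$. In addition the program may use finitely many variables with a fixed finite range of values; these do not count as registers. The number of registers of a machine is the number of integer registers it uses; running time is the number of executed commands. *)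

(* Defs.v *)
From mathcomp Require Import all_boot all_order all_algebra.

Set Implicit Arguments.
Unset Strict Implicit.
Unset Printing Implicit Defensive.

Import Order.TTheory GRing.Theory Num.Theory.
Local Open Scope ring_scope.

Inductive cmp := CLt | CEq | CGt | CNe | CLe | CGe.

Definition cmp_holds (R : cmp) (a b : int) : bool :=
  match R with
  | CLt => a < b
  | CEq => a == b
  | CGt => a > b
  | CNe => a != b
  | CLe => a <= b
  | CGe => a >= b
  end.

(* Commands over n integer registers 'I_n and f auxiliary variables 'I_f, each
   of the latter ranging over the finite nonempty set {0, ..., r} = 'I_r.+1.
   Auxiliary variables never exchange data with the registers. *)
Inductive cmd (n f r : nat) :=
| AddRR (x y z : 'I_n)
| AddRK (x y : 'I_n) (k : int)
| SubRR (x y z : 'I_n)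
| SubRK (x y : 'I_n) (k : int)
| SubKR (x : 'I_n) (k : int) (y : 'I_n)
| SetK (x : 'I_n) (k : int)
| Read (x : 'I_n)
| Write (x : 'I_n)
| IfRR (x : 'I_n) (R : cmp) (y : 'I_n) (thn els : seq (cmd n f r))
| IfRK (x : 'I_n) (R : cmp) (k : int) (thn els : seq (cmd n f r))
| VSetK (v : 'I_f) (d : 'I_r.+1)
| VCopy (v w : 'I_f)
| IfVV (v : 'I_f) (R : cmp) (w : 'I_f) (thn els : seq (cmd n f r))
| IfVK (v : 'I_f) (R : cmp) (d : 'I_r.+1) (thn els : seq (cmd n f r))
| Goto (l : nat).

(* Only the integer registers are counted by the parameter n.  The i-th element
   (from 0) of the code is the line with number i. *)
Record machine (n : nat) := Machine {
  nvars : nat;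
  maxval : nat;
  code : seq (cmd n nvars maxval)
}.

(* [todo] is the sequence of commands still to be executed unless a jump
   intervenes: the rest of the current line followed by the subsequent lines. *)
Record config (n f r : nat) := Config {
  todo : seq (cmd n f r);
  regs : 'I_n -> int;
  vars : 'I_f -> 'I_r.+1;
  input : seq int;
  output : seq int
}.

(* The result is None if there is nothing left to execute, or if a read command
   finds the input exhausted; the latter is a failure, not a regular halt.  A
   jump behind the last line leaves nothing to execute. *)
Definition step (n f r : nat) (P : seq (cmd n f r)) (c : config n f r) :
    option (config n f r) :=
  let: Config t g s i o := c in
  match t with
  | [::] => None
  | a :: t' =>
    let assign x e := Some (Config t' [eta g with x |-> e] s i o) in
    let vassign v d := Some (Config t' g [eta s with v |-> d] i o) in
    let branch (b : bool) thn els :=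
      Some (Config ((if b then thn else els) ++ t') g s i o) in
    match a with
    | AddRR x y z => assign x (g y + g z)
    | AddRK x y k => assign x (g y + k)
    | SubRR x y z => assign x (g y - g z)
    | SubRK x y k => assign x (g y - k)
    | SubKR x k y => assign x (k - g y)
    | SetK x k => assign x k
    | Read x =>
      if i is e :: i' then Some (Config t' [eta g with x |-> e] s i' o)
      else None
    | Write x => Some (Config t' g s i (rcons o (g x)))
    | IfRR x R y thn els => branch (cmp_holds R (g x) (g y)) thn els
    | IfRK x R k thn els => branch (cmp_holds R (g x) k) thn els
    | VSetK v d => vassign v d
    | VCopy v w => vassign v (s w)
    | IfVV v R w thn els =>
      branch (cmp_holds R (Posz (s v)) (Posz (s w))) thn els
    | IfVK v R d thn els => branch (cmp_holds R (Posz (s v)) (Posz d)) thn els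
    | Goto l => Some (Config (drop l P) g s i o)
    end
  end.

Definition steps (n f r : nat) (P : seq (cmd n f r)) (k : nat)
    (c : config n f r) : option (config n f r) :=
  iter k (fun oc => obind (step P) oc) (Some c).

Definition halted (n f r : nat) (c : config n f r) : Prop := todo c = [::].

Definition halts_from (n : nat) (M : machine n) (g : 'I_n -> int)
    (s : 'I_(nvars M) -> 'I_(maxval M).+1) (inp out : seq int) (t : nat) :
    Prop :=
  exists c : config n (nvars M) (maxval M),
    [/\ steps (code M) t (Config (code M) g s inp [::]) = Some c,
        halted c & output c = out].

(* The initial contents of registers and variables are unspecified, so a
   program may not rely on them: [inp] must be mapped to [out] within the time
   bound whatever they are. *)
Definition outputs_within (n : nat) (M : machine n) (inp out : seq int)
    (T : nat) : Prop :=
  forall (g : 'I_n -> int) (s : 'I_(nvars M) -> 'I_(maxval M).+1),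
    exists2 t : nat, (t <= T)%N & halts_from g s inp out t.

Definition is_quotient_length (y z : int) (m : nat) : Prop :=
  (`|y| <= 2 ^+ m * `|z|) /\
  (forall k : nat, `|y| <= 2 ^+ k * `|z| -> (m <= k)%N).

(* Main.v *)
Require Import Defs.
From mathcomp Require Import all_boot all_order all_algebra.
From mathcomp Require Import zify ring.

Set Implicit Arguments.
Unset Strict Implicit.
Unset Printing Implicit Defensive.

Import Order.TTheory GRing.Theory Num.Theory.
Local Open Scope ring_scope.

(** After making [z] positive, double a copy [Z] of [z] until [- Z <= y < Z],
    say [Z = 2 ^ j * z].  An addition machine cannot halve [Z] back to [z], so
    instead the scaled dividend is doubled: the binary digits of the quotient
    come out from the top by the recursion [r := 2 r - d Z], [q := 2 q + d],
    which keeps [q Z + r = 2 ^ i * y] and [0 <= r < Z], starting from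
    [q = 0, r = y] or, if [y < 0], from [q = -1, r = y + Z].  The rounds are counted
    by doubling [z] itself until it reaches [Z]; no counter is needed beyond
    the four registers [r], [z], [Z] and [q]. *)

(** An arbitrary start configuration allows induction over a loop from its head; [T] is only an
    upper bound, so branches of different length share one count. *)
Definition halts_within (n f r : nat) (P : seq (cmd n f r)) (T : nat)
    (c : config n f r) (out : seq int) : Prop :=
  exists2 t : nat, (t <= T)%N &
    exists c', [/\ steps P t c = Some c', halted c' & output c' = out].

Lemma halts_within_halted (n f r : nat) (P : seq (cmd n f r)) T c :
  halted c -> halts_within P T c (output c).
Proof. by move=> hc; exists 0%N => //; exists c. Qed.

Lemma halts_within_leq (n f r : nat) (P : seq (cmd n f r)) T T' c out :
  (T <= T')%N -> halts_within P T c out -> halts_within P T' c out.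
Proof. by move=> leTT' [t letT h]; exists t => //; exact: leq_trans leTT'. Qed.

Lemma halts_within_step (n f r : nat) (P : seq (cmd n f r)) T c c' out :
  step P c = Some c' -> halts_within P T c' out -> halts_within P T.+1 c out.
Proof.
move=> cc' [t letT [c'' [hs hh ho]]]; exists t.+1 => //.
by exists c''; split=> //; rewrite /steps iterSr /= cc'.
Qed.

(* [rW] holds [z] and its doublings; [rQ] also serves as scratch space for [- Z]
   before the quotient is started. *)
Definition rR : 'I_4 := @Ordinal 4 0 isT.
Definition rW : 'I_4 := @Ordinal 4 1 isT.
Definition rZ : 'I_4 := @Ordinal 4 2 isT.
Definition rQ : 'I_4 := @Ordinal 4 3 isT.

Definition div_code : seq (cmd 4 0 0) :=
  [:: Read _ _ rR;
      Read _ _ rW;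
      IfRK rW CLt 0 [:: SubKR _ _ rR 0 rR; SubKR _ _ rW 0 rW] [::];
      AddRK _ _ rZ rW 0;
(*4*) SubKR _ _ rQ 0 rZ;
      IfRR rR CLt rQ [:: AddRR _ _ rZ rZ rZ; Goto _ _ _ 4] [::];
      IfRR rR CGe rZ [:: AddRR _ _ rZ rZ rZ; Goto _ _ _ 4] [::];
      SetK _ _ rQ 0;
      IfRK rR CLt 0 [:: AddRR _ _ rR rR rZ; SetK _ _ rQ (-1)] [::];
(*9*) IfRR rW CGe rZ [:: Write _ _ rQ; Goto _ _ _ 15] [::];
      AddRR _ _ rW rW rW;
      AddRR _ _ rR rR rR;
      AddRR _ _ rQ rQ rQ;
      IfRR rR CGe rZ [:: SubRR _ _ rR rR rZ; AddRK _ _ rQ rQ 1] [::];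
      Goto _ _ _ 9].

Ltac exec := apply: halts_within_step; first by [].

(** With [j] rounds left, [2 ^+ j * (q Z + r)] is unchanged by a round, whichever digit it yields.
    At [j = 0], [0 <= r < Z] forces [q = x]. A round costs at most 8 commands, the exit 3. *)
Lemma digit_loop (j : nat) (g : 'I_4 -> int) s x :
  0 < g rW -> g rZ = 2 ^+ j * g rW -> 0 <= g rR < g rZ ->
  x * g rZ <= 2 ^+ j * (g rQ * g rZ + g rR) < (x + 1) * g rZ ->
  halts_within div_code (8 * j + 3) (Config (drop 9 div_code) g s [::] [::])
    [:: x].
Proof.
elim: j g s => [|j IHj] g s w0 Zw /andP[r0 rZ_] /andP[x1 x2].
  exec. rewrite /= Zw expr0 mul1r lexx. exec. exec.
  have -> : x = g rQ by move: x1 x2; rewrite expr0 mul1r; nia.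
  exact: halts_within_halted.
have e1 : (1 : int) <= 2 ^+ j by rewrite exprn_ege1.
rewrite exprS in Zw x1 x2.
have -> : (8 * j.+1 + 3 = (8 * j + 3).+1.+4.+3)%N by lia.
exec; rewrite /= ifF; last by apply/negbTE; rewrite -ltNge Zw; nia.
exec; exec; exec; exec.
rewrite /=; case: ifPn => cmpr.
  exec; exec; exec; apply: IHj => /=.
  - by lia.
  - by rewrite Zw; ring.
  - by lia.
  - have -> : 2 ^+ j * ((g rQ + g rQ + 1) * g rZ + (g rR + g rR - g rZ))
      = 2 * 2 ^+ j * (g rQ * g rZ + g rR) by ring.
    by rewrite x1 x2.
apply: (@halts_within_leq _ _ _ _ (8 * j + 3).+1); first by lia.
exec; apply: IHj => /=.
- by lia.
- by rewrite Zw; ring.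
- by lia.
- have -> : 2 ^+ j * ((g rQ + g rQ) * g rZ + (g rR + g rR))
    = 2 * 2 ^+ j * (g rQ * g rZ + g rR) by ring.
  by rewrite x1 x2.
Qed.

(** Both range tests fail, and at most 7 commands lead to the digit loop. Multiplying the bounds on
    [x] by [2 ^+ j] replaces [z] by [Z], which gives the loop's invariant. *)
Lemma scaled_run (j T : nat) (g : 'I_4 -> int) s x :
  0 < g rW -> g rZ = 2 ^+ j * g rW -> - g rZ <= g rR < g rZ ->
  x * g rW <= g rR < (x + 1) * g rW -> (8 * j + 10 <= T)%N ->
  halts_within div_code T (Config (drop 4 div_code) g s [::] [::]) [:: x].
Proof.
move=> w0 Zw /andP[lo hi] /andP[x1 x2] /halts_within_leq; apply.
have e1 : (1 : int) <= 2 ^+ j by rewrite exprn_ege1.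
have -> : (8 * j + 10 = (8 * j + 3).+4.+3)%N by lia.
exec; exec; rewrite /= ifF; last by lia.
exec; rewrite /= ifF; last by lia.
exec; exec; rewrite /=; case: ifPn => sgn.
  exec; exec; apply: (@digit_loop j) => //=; first by lia.
  by rewrite Zw; apply/andP; split; nia.
apply: (@halts_within_leq _ _ _ _ (8 * j + 3)); first lia.
apply: (@digit_loop j) => //=; first by lia.
by rewrite Zw; apply/andP; split; nia.
Qed.

(** Here [k] bounds the doublings of [Z] still to come. Each is charged 13: at most 5 commands for
    itself and 8 for the digit round it adds later. *)
Lemma scale_loop (k j : nat) (g : 'I_4 -> int) s x :
  0 < g rW -> g rZ = 2 ^+ j * g rW -> `|g rR| < 2 ^+ k * g rZ ->
  x * g rW <= g rR < (x + 1) * g rW ->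
  halts_within div_code (13 * k + 8 * j + 10)
    (Config (drop 4 div_code) g s [::] [::]) [:: x].
Proof.
elim: k j g s => [|k IHk] j g s w0 Zw yk x12.
  by apply: (scaled_run _ w0 Zw) => //; move: yk; rewrite expr0 mul1r; lia.
have dbl : 2 ^+ k * (g rZ + g rZ) = 2 ^+ k.+1 * g rZ by rewrite exprS; ring.
have [lo|lo] := ltP (g rR) (- g rZ).
  apply: (@halts_within_leq _ _ _ _ (13 * k + 8 * j.+1 + 10).+4); first lia.
  exec; exec; rewrite /= ifT; last by lia.
  exec; exec; apply: IHk => //=; rewrite ?dbl //.
  by rewrite Zw exprS; ring.
have [hi|hi] := ltP (g rR) (g rZ).
  by apply: (scaled_run _ w0 Zw) => //; [rewrite lo | lia].
apply: (@halts_within_leq _ _ _ _ (13 * k + 8 * j.+1 + 10).+4.+1); first lia.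
exec; exec; rewrite /= ifF; last by lia.
exec; rewrite /= ifT; last by lia.
exec; exec; apply: IHk => //=; rewrite ?dbl //.
by rewrite Zw exprS; ring.
Qed.

Lemma floor_ratio_bounds (y z : int) : 0 < z ->
  Num.floor (y%:~R / z%:~R : rat) * z <= y
    < (Num.floor (y%:~R / z%:~R : rat) + 1) * z.
Proof.
move=> z0; have zq : 0 < z%:~R :> rat by rewrite ltr0z.
rewrite -(ler_int rat) -(ltr_int rat) !intrM -ler_pdivlMr // -ltr_pdivrMr //.
exact: floor_itv.
Qed.

Theorem theorem5 :
  exists (M : machine 4) (C : nat),
    forall (y z : int) (m : nat),
      z != 0 ->
      is_quotient_length y z m ->
      outputs_within M [:: y; z]
        [:: Num.floor (y%:~R / z%:~R : rat)] (C * (m + 1))%N.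
Proof.
(* At most 6 commands precede the scaling loop, which runs with [k = m + 1] and [j = 0]:
   [6 + 13 (m + 1) + 10 <= 29 (m + 1)]. *)
exists (Machine div_code), 29%N => y z m z0 [ym _] g s.
suff: halts_within div_code (29 * (m + 1))
  (Config div_code g s [:: y; z] [::]) [:: Num.floor (y%:~R / z%:~R : rat)] by [].
have e1 : (1 : int) <= 2 ^+ m by rewrite exprn_ege1.
(* The range test [y < Z] is strict, so equality in the bound for [m] can cost one more doubling. *)
have ym1 : `|y| < 2 ^+ m.+1 * `|z| by rewrite exprS; nia.
apply: (@halts_within_leq _ _ _ _ (13 * m.+1 + 8 * 0 + 10).+4.+2); first lia.
exec; exec; exec; rewrite /=; case: ifPn => zs.
  exec; exec; exec; apply: scale_loop => /=.
  - by lia.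
  - by rewrite expr0; lia.
  - by move: ym1; rewrite !sub0r addr0 normrN (ltr0_norm zs).
  - have -> : y%:~R / z%:~R = (0 - y)%:~R / (0 - z)%:~R :> rat.
      by rewrite !sub0r !mulrNz invrN mulrNN.
    by apply: floor_ratio_bounds; lia.
apply: (@halts_within_leq _ _ _ _ (13 * m.+1 + 8 * 0 + 10).+1); first lia.
have zp : 0 < z by lia.
exec; apply: scale_loop => //=.
- by rewrite expr0; lia.
- by move: ym1; rewrite addr0 (gtr0_norm zp).
- exact: floor_ratio_bounds.
Qed.
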